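(* For every integer $t\ge 1$, $$b_2(t)\le 128\cdot 2^t.$$
   Context: For positive integers $t$ and $q$, $b_q(t)$ denotes the smallest integer $n$ such that every coloring of the edges of the complete bipartite graph $K_{n,n}$ with $q$ colors yields a monochromatic copy of $K_{t,t}$ (the complete bipartite graph with $t$ vertices in each class). *)

(* Defs.v *)
From mathcomp Require Import all_boot.

Set Implicit Arguments.
Unset Strict Implicit.
Unset Printing Implicit Defensive.

(* An edge of K_{n,n} is a pair (left vertex, right vertex) in 'I_n * 'I_n, so a
   q-coloring of the edges is a finite function on these pairs. Since K_{t,t} is
   connected for t >= 1, a copy of it in K_{n,n} has one class A on the left and
   the other class B on the right. *)
Definition mono_Ktt (q n t : nat) (col : {ffun 'I_n * 'I_n -> 'I_q}) : bool :=
  [exists c : 'I_q, [exists A : {set 'I_n}, [exists B : {set 'I_n},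
    [&& #|A| == t, #|B| == t &
        [forall a in A, forall b in B, col (a, b) == c]]]]].

Definition forces_Ktt (q t n : nat) : bool :=
  [forall col : {ffun 'I_n * 'I_n -> 'I_q}, mono_Ktt t col].

Lemma pigeonhole (S C : finType) (m : nat) (D : {set S}) (f : S -> C) :
  #|C| * m < #|D| -> exists c : C, m < #|[set x in D | f x == c]|.
Proof.
move=> lt_mD; apply/existsP; apply: contraLR lt_mD => /existsPn small.
rewrite -leqNgt -sum1_card (partition_big f predT) //= -sum_nat_const.
apply: leq_sum => c _; rewrite sum1_card leqNgt.
by apply: contra (small c) => /leq_trans; apply; apply/subset_leq_card/subsetP => x; rewrite !inE.
Qed.

Lemma subset_of_card (S : finType) (D : {set S}) (m : nat) :
  m <= #|D| -> exists2 E : {set S}, E \subset D & #|E| = m.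
Proof.
move=> le_mD; exists [set x in take m (enum D)].
  by apply/subsetP => x; rewrite inE => /mem_take; rewrite mem_enum.
by rewrite cardsE (card_uniqP _) ?take_uniq ?enum_uniq // size_takel // -cardE.
Qed.

Lemma forces_Ktt_exists (q t : nat) : exists n, forces_Ktt q t n.
Proof.
case: q => [|q].
  by exists 1; apply/forallP => col; case: (col (ord0, ord0)).
case: t => [|t].
  exists 0; apply/forallP => col; apply/existsP; exists ord0.
  apply/existsP; exists set0; apply/existsP; exists set0.
  by rewrite !cards0 eqxx /=; apply/forall_inP => a; rewrite inE.
pose k := (q.+1 * t).+1; pose N := #|{: {set 'I_k} * 'I_q.+1}| * t.
exists (k + N.+1); apply/forallP => col.
pose L (i : 'I_k) := lshift N.+1 i.
have rowP (b : 'I_(k + N.+1)) : exists p : {set 'I_k} * 'I_q.+1,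
    (#|p.1| == t.+1) && [forall i in p.1, col (L i, b) == p.2].
  have [|c lt_tc] := @pigeonhole _ _ t [set: 'I_k] (fun i => col (L i, b)).
    by rewrite cardsT !card_ord.
  have [E /subsetP sE cE] := subset_of_card lt_tc.
  exists (E, c); rewrite /= cE eqxx; apply/forall_inP => i /sE.
  by rewrite !inE.
pose g b := xchoose (rowP b).
have [|[T c] lt_tT] :=
    @pigeonhole _ _ t [set: 'I_(k + N.+1)] g.
  by rewrite cardsT card_ord -/N addnS ltnS leq_addl.
have [B /subsetP sB cB] := subset_of_card lt_tT.
have gP b : b \in B ->
    (#|T| == t.+1) && [forall i in T, col (L i, b) == c].
  move=> /sB; rewrite !inE => /eqP gb; have := xchooseP (rowP b).
  by rewrite -/(g b) gb.
have [b0 b0B] : exists b, b \in B by apply/card_gt0P; rewrite cB.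
have /andP[/eqP cT _] := gP _ b0B.
apply/existsP; exists c; apply/existsP; exists (L @: T).
apply/existsP; exists B.
rewrite card_imset ?cT ?cB ?eqxx /=; last exact: lshift_inj.
apply/forall_inP => _ /imsetP[i iT ->]; apply/forall_inP => b bB.
by have /andP[_ /forall_inP/(_ i iT)] := gP _ bB.
Qed.

Definition bip_ramsey (q t : nat) : nat := ex_minn (forces_Ktt_exists q t).

(* Main.v *)
Require Import Defs.
From mathcomp Require Import all_boot.
From mathcomp Require Import zify.

Set Implicit Arguments.
Unset Strict Implicit.
Unset Printing Implicit Defensive.

(** Let n = 128 * 2 ^ t.  The majority colour is a bipartite graph of density at
least 1/2 between two classes X and Y of n vertices, and any such graph
contains K_{t,t}.

Counting stars shows that an average t-subset of X has about n / 2 ^ t = 128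
common neighbours.  This is enough when t < 128, but it loses a factor of
order t in general.  For larger t the two sides of K_{t,t} are built in
rounds.  A set S of s vertices of X is fixed and Y is replaced by the common
neighbourhood of S; then a set of s vertices of the new Y is fixed and X is cut
down in the same way.  When r vertices of each side are still missing, both
classes should have about C * 2 ^ r vertices, with a constant C close to 128.

The difficulty is to choose S so that its common neighbourhood is as large as in
a random graph while the graph that remains is as dense as in a random graph.
Density of edges is the wrong measure: asking for it can cost a constant factor
of the size at each round.  The right one is the number of copies of K_{l,k},
where l and k are the numbers of vertices to be fixed in the two following
half-rounds.  By convexity ([bin_power_mean]) the average over S of that number
is at least what it would be in a random graph, and a constant factor lost in it
is only a factor 1 - O(1/k) in the size of a class, since binomial
coefficients of order k are being compared ([bin_halve], [bin_exp_ratio]).  The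
predicate [rich] records the lower bounds on the number of copies that are
carried along, [exists_average_extension] chooses S, and [rich_step] shows that
richness survives a half-round.

A round leaves 8g vertices missing on each side, with g = 8 * 2 ^ m, and
the next one leaves half as many.  The constant C is 128 * (1 - 3 / g) when 8g
vertices are missing ([rich_round]); as the losses O(1/g) form a geometric
series, it is still 80 at the last stage g = 8.  There 64 vertices are missing
on each side, and 64 common neighbours are found by the pigeonhole principle
([rich_final]). *)

(** * Binomial coefficients: convexity and comparison with powers *)

(** The discrete form of the tangent inequality for z |-> z ^ ((s + 1) / s) at
the value of z = 'C(u, s) at u = c: the difference of the two sides vanishes
at u = c, and decreases before c and increases after it. *)
Lemma bin_tangent (s c u : nat) :
  0 < s -> s * u * 'C(u, s) + c * 'C(c, s) >= s * c * 'C(u, s) + c * 'C(u, s).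
Proof.
case: s => // s _.
have key v : s.+1 * 'C(v.+1, s.+1) = v.+1 * 'C(v, s) by rewrite -mul_bin_diag.
have [le_cu|lt_uc] := leqP c u.
  rewrite -(subnKC le_cu); elim: (u - c) => [|d IH]; first by rewrite addn0.
  rewrite addnS; move: IH; set v := c + d => IH.
  have k := key v; have b := binS v s.
  have: c <= v by rewrite leq_addr.
  move: IH k; rewrite b; move: 'C(v, s) 'C(v, s.+1) 'C(c, s.+1) => x y z; nia.
rewrite -(subKn (ltnW lt_uc)); elim: (c - u) (leq_subr u c) => [|d IH] le_dc;
  first by rewrite subn0.
have {IH} := IH (ltnW le_dc).
have <- : (c - d.+1).+1 = c - d by lia.
set v := c - d.+1 => IH.
have k := key v; have b := binS v s.
have: v < c by lia.
move: IH k; rewrite b; move: 'C(v, s) 'C(v, s.+1) 'C(c, s.+1) => x y z; nia.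
Qed.

(** The power mean inequality between the s-th and the (s + l)-th moments,
with binomial coefficients for powers.  It is a quotient bound for the two
moments, and not only a lower bound for the larger one: the latter would be
too weak when the s-th moment exceeds its assumed lower bound. *)
Lemma bin_power_mean (I : finType) (P : {set I}) (u : I -> nat) (s l c : nat) :
  0 < s -> #|P| * 'C(c, s) <= \sum_(i in P) 'C(u i, s) ->
  'C(c, s + l) * \sum_(i in P) 'C(u i, s) <=
  'C(c, s) * \sum_(i in P) 'C(u i, s + l).
Proof.
move=> s_gt0 hP.
have step r : 0 < r -> #|P| * 'C(c, r) <= \sum_(i in P) 'C(u i, r) ->
    (c - r) * \sum_(i in P) 'C(u i, r) <= r.+1 * \sum_(i in P) 'C(u i, r.+1).
  move=> r_gt0 h.
  have h1 : r * c * (\sum_(i in P) 'C(u i, r))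
       + c * (\sum_(i in P) 'C(u i, r)) <=
     \sum_(i in P) r * u i * 'C(u i, r) + c * (#|P| * 'C(c, r)).
    rewrite !big_distrr -sum_nat_const big_distrr -!big_split /=.
    by apply: leq_sum => i _; apply: bin_tangent.
  have h2 : \sum_(i in P) r * u i * 'C(u i, r) =
     r * (r * (\sum_(i in P) 'C(u i, r)) + r.+1 * \sum_(i in P) 'C(u i, r.+1)).
    rewrite !big_distrr -big_split big_distrr /=; apply: eq_bigr => i _.
    rewrite mul_bin_left.
    have [lt_ur|le_ru] := ltnP (u i) r; first by rewrite bin_small // !muln0.
    by rewrite -mulnA; congr (_ * _); rewrite -mulnDl subnKC.
  rewrite h2 in h1; move: h h1.
  move: (\sum_(i in P) 'C(u i, r)) (\sum_(i in P) 'C(u i, r.+1)) => a b h h1.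
  have h3 : r * (c * a) <= r * (r * a + r.+1 * b) by nia.
  by move: h3; rewrite leq_pmul2l // mulnBl; lia.
elim: l => [|l IH]; first by rewrite addn0.
have [c0|c_gt0] := posnP 'C(c, s + l).
  have -> : 'C(c, s + l.+1) = 0; last by rewrite mul0n.
  apply: bin_small; rewrite addnS ltnS ltnW //.
  by move/eqP: c0; rewrite -leqn0 leqNgt bin_gt0 -ltnNge.
have [s0|cs_gt0] := posnP 'C(c, s).
  have lt : c < s by rewrite ltnNge -bin_gt0 s0.
  by rewrite (bin_small (ltn_addr _ lt)) mul0n.
have hl : #|P| * 'C(c, s + l) <= \sum_(i in P) 'C(u i, s + l).
  rewrite -(leq_pmul2l cs_gt0); apply: leq_trans IH.
  by rewrite mulnCA mulnA mulnC leq_mul2l hP orbT.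
have := step _ (ltn_addr l s_gt0) hl.
have e := mul_bin_left c (s + l).
rewrite addnS; move: IH e hl hP.
move: (\sum_(i in P) 'C(u i, s)) (\sum_(i in P) 'C(u i, s + l)) => a b.
move: (\sum_(i in P) _) => d.
move: 'C(c, s + l) 'C(c, (s + l).+1) 'C(c, s) c_gt0 cs_gt0 =>
  x y z x0 z0 IH e _ _ h.
rewrite -(leq_pmul2l (ltn0Sn (s + l))) mulnA e.
by apply: (@leq_trans ((c - (s + l)) * (z * b))); nia.
Qed.

Lemma bin_choose_twice (u s l : nat) :
  'C(u, s) * 'C(u - s, l) = 'C(s + l, s) * 'C(u, s + l).
Proof.
have [lt_us|le_su] := ltnP u s.
  by rewrite bin_small // (@bin_small _ (s + l)) ?muln0 // ltn_addr.
have [lt_u|le_u] := ltnP u (s + l).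
  by rewrite (@bin_small (u - s)) ?(@bin_small _ (s + l)) ?muln0 //; lia.
apply/eqP; rewrite -(eqn_pmul2r (fact_gt0 s)) -(eqn_pmul2r (fact_gt0 l)).
rewrite -(eqn_pmul2r (fact_gt0 (u - (s + l)))); apply/eqP.
have e1 := bin_fact le_su.
have e2 : 'C(u - s, l) * (l`! * (u - (s + l))`!) = (u - s)`!.
  by rewrite subnDA bin_fact //; lia.
have e3 := bin_fact le_u.
have e4 := bin_fact (leq_addr l s); rewrite addKn in e4.
transitivity (u`!); first by rewrite -e1 -e2; lia.
by rewrite -e3 -e4; lia.
Qed.

(** * Counting complete bipartite subgraphs *)

Definition ksubsets (T : finType) (X : {set T}) (s : nat) : {set {set T}} :=
  [set S : {set T} | (S \subset X) && (#|S| == s)].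

Lemma card_ksubsets (T : finType) (X : {set T}) s :
  #|ksubsets X s| = 'C(#|X|, s).
Proof. exact: cards_draws. Qed.

Definition converse (T1 T2 : Type) (e : T1 -> T2 -> bool) : T2 -> T1 -> bool :=
  fun y x => e x y.

Definition common_nb (T1 T2 : finType) (e : T1 -> T2 -> bool) (Y : {set T2})
  (S : {set T1}) : {set T2} := [set y in Y | [forall x in S, e x y]].

(** The number of copies of K_{s,k}, its class of size s being in X. *)
Definition numK (T1 T2 : finType) (e : T1 -> T2 -> bool) (X : {set T1})
  (Y : {set T2}) (s k : nat) : nat :=
  \sum_(S in ksubsets X s) 'C(#|common_nb e Y S|, k).

Lemma common_nb_sub (T1 T2 : finType) (e : T1 -> T2 -> bool) (Y : {set T2})
    (S : {set T1}) : common_nb e Y S \subset Y.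
Proof. by apply/subsetP => y; rewrite inE => /andP[]. Qed.

Lemma common_nb_galois (T1 T2 : finType) (e : T1 -> T2 -> bool) (X : {set T1})
    (Y : {set T2}) (S : {set T1}) (K : {set T2}) :
  S \subset X -> K \subset Y ->
  (K \subset common_nb e Y S) = (S \subset common_nb (converse e) X K).
Proof.
move=> /subsetP sX /subsetP kY; apply/subsetP/subsetP => h z.
  move=> zS; rewrite inE sX //=; apply/forall_inP => y /h.
  by rewrite inE => /andP[_ /forall_inP/(_ z zS)].
move=> zK; rewrite inE kY //=; apply/forall_inP => x /h.
by rewrite inE => /andP[_ /forall_inP/(_ z zK)].
Qed.

Lemma ksubsets_common_nb (T1 T2 : finType) (e : T1 -> T2 -> bool) (X : {set T1})
    (Y : {set T2}) s k (S : {set T1}) (K : {set T2}) :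
  ((S \in ksubsets X s) && (K \in ksubsets (common_nb e Y S) k)) =
  ((K \in ksubsets Y k) && (S \in ksubsets (common_nb (converse e) X K) s)).
Proof.
rewrite !inE; apply/idP/idP => /andP[/andP[a ->] /andP[b ->]]; rewrite !andbT.
  have bY := subset_trans b (common_nb_sub _ _ _).
  by rewrite bY -(common_nb_galois e a bY).
have bX := subset_trans b (common_nb_sub _ _ _).
by rewrite bX (common_nb_galois e bX a).
Qed.

Lemma sum_ksubsets_common_nb (T1 T2 : finType) (e : T1 -> T2 -> bool)
    (X : {set T1}) (Y : {set T2}) s k (F : {set T1} -> {set T2} -> nat) :
  \sum_(S in ksubsets X s) \sum_(K in ksubsets (common_nb e Y S) k) F S K =
  \sum_(K in ksubsets Y k) \sum_(S in ksubsets (common_nb (converse e) X K) s)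
    F S K.
Proof.
rewrite (exchange_big_dep (fun K => K \in ksubsets Y k)) /=.
  apply: eq_bigr => K kY; apply: eq_bigl => S.
  by rewrite ksubsets_common_nb kY.
by move=> S K h1 h2; have := ksubsets_common_nb e X Y s k S K;
  rewrite h1 h2 => /esym/andP[].
Qed.

(** Both sides count pairs (S, K) that are completely joined; the two sides of
the bipartite graph play symmetric roles from here on. *)
Lemma numK_converse (T1 T2 : finType) (e : T1 -> T2 -> bool) (X : {set T1})
    (Y : {set T2}) s k :
  numK e X Y s k = numK (converse e) Y X k s.
Proof.
transitivity (\sum_(S in ksubsets X s) \sum_(K in ksubsets (common_nb e Y S) k)
  1).
  by apply: eq_bigr => S _; rewrite sum1_card card_ksubsets.
by rewrite sum_ksubsets_common_nb; apply: eq_bigr => K _;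
  rewrite sum1_card card_ksubsets.
Qed.

(** Fixing S and then a K_{l,k} in what remains is the same as choosing a
K_{s+l,k} and marking s of the s + l vertices on its left side. *)
Lemma sum_numK_rest (T1 T2 : finType) (e : T1 -> T2 -> bool) (X : {set T1})
    (Y : {set T2}) s k l :
  \sum_(S in ksubsets X s) numK e (X :\: S) (common_nb e Y S) l k =
  'C(s + l, s) * numK e X Y (s + l) k.
Proof.
rewrite [in RHS]numK_converse.
transitivity (\sum_(S in ksubsets X s) \sum_(K in ksubsets (common_nb e Y S) k)
    'C(#|common_nb (converse e) X K| - s, l)).
  apply: eq_bigr => S; rewrite inE => /andP[sX /eqP cS].
  rewrite numK_converse; apply: eq_bigr => K; rewrite inE => /andP[kY _].
  have kY' := subset_trans kY (common_nb_sub _ _ _).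
  rewrite (common_nb_galois e sX kY') in kY.
  congr 'C(_, l); rewrite -cS -(cardsDS kY); apply: eq_card => x.
  by rewrite !inE andbA.
rewrite sum_ksubsets_common_nb big_distrr; apply: eq_bigr => K _ /=.
rewrite sum_nat_const card_ksubsets; set u := #|_|.
exact: bin_choose_twice.
Qed.

(** By the power mean inequality, the number of K_{l,k} that remain is on
average, over S, at least 'C(c - s, l) times the number of k-subsets of the
common neighbourhood of S.  Half of this average pays for the first summand, so
that the copies are many relative to the size of the new class; the other half
pays for the second one, so that they are also many absolutely. *)
Lemma exists_average_extension (T1 T2 : finType) (e : T1 -> T2 -> bool)
    (X : {set T1}) (Y : {set T2}) s k l c a :
  0 < s -> s <= c -> s <= #|X| ->
  'C(#|X|, s) * a <= numK e X Y s k ->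
  'C(c, s) * 'C(#|Y|, k) <= numK e X Y s k ->
  exists2 S, S \in ksubsets X s &
    'C(c - s, l) * ('C(#|common_nb e Y S|, k) + a) <=
      2 * numK e (X :\: S) (common_nb e Y S) l k.
Proof.
move=> s_gt0 le_sc le_sX hA hc.
have tot : 'C(c - s, l) * numK e X Y s k <=
    \sum_(S in ksubsets X s) numK e (X :\: S) (common_nb e Y S) l k.
  have cs0 : 0 < 'C(c, s) by rewrite bin_gt0.
  rewrite -(leq_pmul2l cs0) sum_numK_rest.
  have pm := @bin_power_mean _ (ksubsets Y k) (fun K =>
    #|common_nb (converse e) X K|) s l c s_gt0.
  rewrite (numK_converse e X Y s k) (numK_converse e X Y (s + l) k).
  rewrite mulnA bin_choose_twice -mulnA [leqRHS]mulnCA leq_mul2l; apply/orP;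
    right.
  apply: pm; rewrite card_ksubsets mulnC; apply: leq_trans hc _.
  by rewrite numK_converse.
have [/exists_inP[S ? ?]|/exists_inPn no] := boolP
  [exists S in ksubsets X s, 'C(c - s, l) * ('C(#|common_nb e Y S|, k) + a) <=
      2 * numK e (X :\: S) (common_nb e Y S) l k]; first by exists S.
have : \sum_(S in ksubsets X s)
      ((2 * numK e (X :\: S) (common_nb e Y S) l k).+1) <=
    \sum_(S in ksubsets X s) 'C(c - s, l) * ('C(#|common_nb e Y S|, k) + a).
  by apply: leq_sum => S /no; rewrite -ltnNge.
rewrite -big_distrr big_split /= -/(numK e X Y s k) sum_nat_const card_ksubsets.
under eq_bigr do rewrite -addn1.
rewrite big_split /= -big_distrr sum1_card card_ksubsets /=.
have x0 : 0 < 'C(#|X|, s) by rewrite bin_gt0.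
move: tot hA x0; move: (\sum_(S in _) _) (numK _ _ _ _ _) => p q.
move: 'C(c - s, l) 'C(#|X|, s) => w x; nia.
Qed.

(** * Elementary estimates *)

Lemma expn_mono (m n k : nat) : m <= n -> m ^ k <= n ^ k.
Proof. by case: k => // k; rewrite leq_exp2r. Qed.

(** Each factor (b - i) / (a - i) of the quotient of falling factorials is at
least b / a. *)
Lemma bin_ratio_le (a b l : nat) :
  a <= b -> 'C(a, l) * b ^ l <= 'C(b, l) * a ^ l.
Proof.
move=> le_ab; elim: l => [|l IH]; first by rewrite !bin0.
rewrite -(leq_pmul2l (ltn0Sn l)) !mulnA !mul_bin_left !expnS.
have h : (a - l) * b <= (b - l) * a by nia.
apply: leq_trans (_ : (b - l) * a * ('C(b, l) * a ^ l) <= _); last by nia.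
by apply: leq_trans (leq_mul h IH); nia.
Qed.

Lemma subn_exp_le_ffact (c l : nat) : (c.+1 - l) ^ l <= c ^_ l.
Proof.
elim: l c => [|l IH] c; first by rewrite ffactn0.
rewrite ffactnSr expnSr subSS leq_mul //.
by apply: leq_trans (IH c); apply: expn_mono; lia.
Qed.

Lemma ffact_le_exp (c l : nat) : c ^_ l <= c ^ l.
Proof.
by elim: l => [|l IH]; rewrite ?ffactn0 // ffactnSr expnSr leq_mul // leq_subr.
Qed.

Lemma expn_sub_ge (n d l : nat) : n ^ l <= (n - d) ^ l + l * d * n ^ l.-1.
Proof.
have [lt_nd|le_dn] := ltnP n d.
  case: l => [|l] //=; apply: leq_trans (leq_addl _ _).
  by rewrite expnS leq_mul2r; apply/orP; right; nia.
elim: l => [|l IH] //=.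
case: l IH => [|l]; first by rewrite !expn1 !expn0; lia.
rewrite /= => IH; rewrite expnS.
apply: leq_trans (leq_mul (leqnn n) IH) _.
rewrite [(n - d) ^ l.+2]expnS mulnDr.
have e : n ^ l.+1 = n * n ^ l by rewrite expnS.
have h : (n - d) ^ l.+1 <= n ^ l.+1 by rewrite leq_exp2r // leq_subr.
rewrite e in h *.
by move: ((n - d) ^ l.+1) (n ^ l) h => p q h; nia.
Qed.

Lemma expn_le_half (n d l : nat) : 2 * l * d <= n -> n ^ l <= 2 * (n - d) ^ l.
Proof.
case: l => [|l] h //; have := expn_sub_ge n d l.+1 => /=.
have e : n ^ l.+1 = n * n ^ l by rewrite expnS.
rewrite e; move: ((n - d) ^ l.+1) (n ^ l) => p q; nia.
Qed.

(** * Rich pairs of classes *)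

(** Three lower bounds on the number of copies of K_{s,k}: an average s-subset
of X has k-subsets of its common neighbourhood as if there were a common
neighbours; an average k-subset of Y similarly has b; and K_{s,k} has density
at least 2 ^ - (s * k + 4). The three bounds are all needed because the sizes
of X and Y are not controlled: a class may be smaller than expected in a graph
that is denser in return. The factor 2 ^ 4 is the loss that reproduces itself
in [rich_step], where it is halved in the exponent, as 2 * l <= s, and then
multiplied by 4. *)
Definition rich (T1 T2 : finType) (e : T1 -> T2 -> bool) (X : {set T1})
    (Y : {set T2}) (s k a b : nat) : Prop :=
  [/\ 0 < numK e X Y s k,
      'C(#|X|, s) * 'C(a, k) <= numK e X Y s k,
      'C(b, s) * 'C(#|Y|, k) <= numK e X Y s k &
      'C(#|X|, s) * 'C(#|Y|, k) <= 2 ^ (s * k + 4) * numK e X Y s k].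

Lemma numK_le (T1 T2 : finType) (e : T1 -> T2 -> bool) (X : {set T1})
    (Y : {set T2}) s k : numK e X Y s k <= 'C(#|X|, s) * 'C(#|Y|, k).
Proof.
rewrite -card_ksubsets -sum_nat_const; apply: leq_sum => S _.
by apply/leq_bin2l/subset_leq_card/common_nb_sub.
Qed.

Lemma numK_pigeonhole (T1 T2 : finType) (e : T1 -> T2 -> bool) (X : {set T1})
    (Y : {set T2}) s k m :
  'C(#|X|, s) * 'C(m.-1, k) < numK e X Y s k -> 0 < numK e X Y s m.
Proof.
apply: contraTT; rewrite -eqn0Ngt -leqNgt sum_nat_eq0 => /forall_inP none.
rewrite -card_ksubsets -sum_nat_const; apply: leq_sum => L /none.
by rewrite eqn0Ngt bin_gt0 -ltnNge => lt_m; apply: leq_bin2l; lia.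
Qed.

Lemma leq_bin_add (c s : nat) : 0 < s -> c <= 'C(c, s) + s.
Proof.
case: s => // s _; elim: c => // c IH.
rewrite binS; have [lt_cs|le_sc] := ltnP c s; first by lia.
have : 0 < 'C(c, s) by rewrite bin_gt0.
by lia.
Qed.

(** The bound c is the largest one for which the average number of s-subsets
of a common neighbourhood is at least 'C(c, s).  So c >= b, and the density
bound of [rich] makes c nearly as large as #|X| / 2 ^ k. *)
Lemma exists_extension (T1 T2 : finType) (e : T1 -> T2 -> bool) (X : {set T1})
    (Y : {set T2}) s k l a b :
  0 < s -> s <= b -> rich e X Y s k a b ->
  exists c S, [/\ b <= c, #|X| ^ s <= 2 ^ (s * k + 4) * c.+1 ^ s,
    S \in ksubsets X s &
    'C(c - s, l) * ('C(#|common_nb e Y S|, k) + 'C(a, k)) <=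
      2 * numK e (X :\: S) (common_nb e Y S) l k].
Proof.
move=> s_gt0 le_sb [W0 h1 h2 h3].
have := leq_trans W0 (numK_le e X Y s k).
rewrite muln_gt0 bin_gt0 => /andP[le_sX y0].
set P := fun c => 'C(c, s) * 'C(#|Y|, k) <= numK e X Y s k.
have ubP c : P c -> c <= numK e X Y s k + s.
  move=> Pc; apply: leq_trans (leq_bin_add c s_gt0) _.
  by rewrite leq_add2r; apply: leq_trans Pc; apply: leq_pmulr.
have exP : exists c, P c by exists b.
case: (ex_maxnP exP ubP) => c Pc maxc.
have le_bc : b <= c by apply: maxc.
have [S SX hS] := @exists_average_extension _ _ e X Y s k l c _ s_gt0
  (leq_trans le_sb le_bc) le_sX h1 Pc.
exists c, S; split => //.
have [lt_Xc|le_cX] := ltnP #|X| c.+1.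
  apply: (@leq_trans (c.+1 ^ s)); first by rewrite leq_exp2r // ltnW.
  by apply: leq_pmull; rewrite expn_gt0.
have hc : numK e X Y s k < 'C(c.+1, s) * 'C(#|Y|, k).
  by rewrite ltnNge; apply/negP => /maxc; rewrite ltnn.
have c0 : 0 < 'C(c.+1, s) by rewrite bin_gt0; lia.
have hX : 'C(#|X|, s) <= 2 ^ (s * k + 4) * 'C(c.+1, s).
  rewrite -(leq_pmul2r y0) -mulnA; apply: leq_trans h3 _.
  by rewrite leq_mul2l (ltnW hc) orbT.
rewrite -(leq_pmul2l c0); have := bin_ratio_le s le_cX; move: hX.
move: ('C(c.+1, s)) ('C(#|X|, s)) (2 ^ (s * k + 4)) c0 => p q r p0 hX h.
apply: leq_trans h _; rewrite mulnA leq_mul2r; apply/orP; right.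
by rewrite mulnC.
Qed.

(** Removing d + l from c is harmless when c is at least quadratic in l and d:
the l-th power changes by a factor of at most 2. *)
Lemma bin_le_of_exp (x c d l r : nat) :
  2 * l * (d + l) <= c.+1 -> x ^ l <= r * c.+1 ^ l ->
  'C(x, l) <= 2 * r * 'C(c - d, l).
Proof.
move=> hc hx; rewrite -(leq_pmul2r (fact_gt0 l)) -mulnA !bin_ffact.
apply: leq_trans (ffact_le_exp _ _) _; apply: leq_trans hx _.
rewrite -mulnA mulnCA leq_mul2l; apply/orP; right.
apply: leq_trans (expn_le_half hc) _; rewrite leq_mul2l /=.
apply: leq_trans (subn_exp_le_ffact _ _).
by case: l {hc} => // l; rewrite leq_exp2r //; lia.
Qed.

(** A factor in s-th powers becomes its square root in l-th powers. *)
Lemma expn_descend (x z s l : nat) : 2 * l <= s -> 0 < z ->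
  x ^ s <= 2 ^ 4 * z ^ s -> x ^ l <= 4 * z ^ l.
Proof.
move=> hl z0 h; have [le_xz|lt_zx] := leqP x z.
  apply: leq_trans (leq_pmull _ _) => //.
  by case: l {hl} => // l; rewrite leq_exp2r.
rewrite -leq_sqr -!expnM expnMn -!expnM [l * 2]mulnC.
rewrite -(leq_pmul2r (_ : 0 < z ^ (s - 2 * l))) ?expn_gt0 ?z0 //.
rewrite -mulnA -expnD subnKC //.
apply: (leq_trans _ h); rewrite -{2}(subnKC hl) expnD leq_mul2l.
apply/orP; right; case: (s - 2 * l) => // n.
by rewrite leq_exp2r // ltnW.
Qed.

(** One half-round: fix s vertices in X, and exchange the roles of the
classes. The new first bound a' comes from b, at the cost of the factor 2 of
[exists_extension]; the new second bound b' comes from a and the density. *)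
Lemma rich_step (T1 T2 : finType) (e : T1 -> T2 -> bool) (X : {set T1})
    (Y : {set T2}) s k l a b a' b' :
  0 < l -> 2 * l <= s -> k <= a -> 2 * l * (s + l) <= b ->
  2 * 'C(a', l) <= 'C(b - s, l) ->
  2 ^ (k * l + 4) * 'C(b', k) <= 'C(a, k) ->
  rich e X Y s k a b ->
  exists2 S, S \in ksubsets X s &
    rich (converse e) (common_nb e Y S) (X :\: S) k l a' b'.
Proof.
move=> l0 hl ka hb ha' hb' st.
have s0 : 0 < s by lia.
have sb : s <= b by nia.
have [c [S [bc hx SX hS]]] := exists_extension l s0 sb st.
exists S => //; move: SX; rewrite inE => /andP[SX _].
rewrite /rich -numK_converse; move: hS; set W' := numK _ _ _ _ _.
move: #|common_nb e Y S| => y' hS.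
(* The 2 ^ 4 of the density becomes 2 ^ 2 in l-th powers, and the shift of c by
   s + l brings it to 2 ^ 3. *)
have hxl : 'C(#|X|, l) <= 2 ^ (k * l + 3) * 'C(c - s, l).
  have -> : 2 ^ (k * l + 3) = 2 * (4 * (2 ^ k) ^ l).
    by rewrite -expnM mulnA (_ : 2 * 4 = 2 ^ 3) // -expnD addnC.
  apply: bin_le_of_exp; first by apply: leq_trans hb _; lia.
  rewrite -mulnA -expnMn; apply: expn_descend hl _ _.
    by rewrite muln_gt0 expn_gt0.
  apply: leq_trans hx _.
  by rewrite addnC expnD -mulnA expnMn -expnM [k * s]mulnC.
have hx' : 'C(#|X :\: S|, l) <= 'C(#|X|, l).
  by apply/leq_bin2l/subset_leq_card/subsetDl.
have hbc : 'C(b - s, l) <= 'C(c - s, l) by apply: leq_bin2l; lia.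
have a0 : 0 < 'C(a, k) by rewrite bin_gt0.
have w0 : 0 < 'C(c - s, l) by rewrite bin_gt0; nia.
have e2 : 2 ^ (k * l + 4) = 2 * 2 ^ (k * l + 3) by rewrite !expnD; lia.
rewrite e2 in hb' *.
have r0 : 0 < 2 ^ (k * l + 3) by rewrite expn_gt0.
move: (2 ^ (k * l + 3)) r0 hxl hb' => r r0 hxl hb'.
move: #|X :\: S| hx' => x' hx'.
split.
- by rewrite -(@ltn_pmul2l 2) //; apply: leq_trans hS;
  rewrite muln0 muln_gt0 w0 addn_gt0 a0 orbT.
- rewrite -(@leq_pmul2l 2) //; apply: leq_trans hS.
  move: 'C(y', k) 'C(a', l) 'C(a, k) 'C(c - s, l) ('C(b - s, l)) hbc ha'; nia.
- rewrite -(@leq_pmul2l (2 * r)) ?muln_gt0 //.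
  have h1 : 2 * r * 'C(b', k) * 'C(x', l) <= 'C(a, k) * (r * 'C(c - s, l)).
    by apply: leq_mul hb' (leq_trans hx' hxl).
  by apply: leq_trans (_ : r * ('C(c - s, l) * 'C(a, k)) <= _); nia.
- have h1 : 'C(x', l) <= r * 'C(c - s, l) by apply: leq_trans hx' hxl.
  apply: leq_trans (leq_mul (leqnn _) h1) _.
  by move: 'C(y', k) 'C(c - s, l) hS; nia.
Qed.

(** * One round *)

Lemma bernoulli (l n : nat) : n ^ l.+1 + l.+1 * n ^ l <= n.+1 ^ l.+1.
Proof.
elim: l => [|l IH]; first by rewrite !expn1 expn0; lia.
rewrite expnS [n.+1 ^ l.+2]expnS.
apply: leq_trans (_ : n.+1 * (n ^ l.+1 + l.+1 * n ^ l) <= _);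
  last by rewrite leq_mul2l IH orbT.
by rewrite [n ^ l.+1]expnS; move: (n ^ l) => p; nia.
Qed.

Lemma double_exp_le (l : nat) : 0 < l -> 2 * l ^ l <= l.+1 ^ l.
Proof.
by case: l => // l _; have := bernoulli l l.+1; rewrite -expnS addnn -mul2n.
Qed.

(** In l-th moments a factor 2 costs a factor l / (l + 1) in size. *)
Lemma bin_halve (m a l : nat) :
  0 < l -> a * l.+1 <= l * m -> 2 * 'C(a, l) <= 'C(m, l).
Proof.
move=> l0 h; have [m0|m_gt0] := posnP m.
  have -> : a = 0 by move: h; rewrite m0; nia.
  by rewrite bin_small.
have ham : a <= m by nia.
have ml : 0 < m ^ l by rewrite expn_gt0 m_gt0.
have ll : 0 < l ^ l by rewrite expn_gt0 l0.
rewrite -(leq_pmul2r (_ : 0 < m ^ l * l ^ l)) ?muln_gt0 ?ml //.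
have := bin_ratio_le l ham; have := double_exp_le l0; have := expn_mono l h.
rewrite !expnMn.
move: (m ^ l) (l ^ l) (a ^ l) (l.+1 ^ l) 'C(a, l) 'C(m, l) ml ll.
move=> M L A K x y M0 L0 h1 h2 h3.
have h4 : 2 * (x * M) * L <= 2 * (y * A) * L by nia.
have h5 : y * (A * (2 * L)) <= y * (A * K) by rewrite !leq_mul2l h2 !orbT.
have h6 : y * (A * K) <= y * (L * M) by rewrite leq_mul2l h1 orbT.
by lia.
Qed.

(** Similarly, a factor 2 ^ 4 in k-th moments costs a factor q / (q + 1) in
size, because (1 + 1 / q) ^ (4 * q) >= 2 ^ 4; the factor 2 ^ l is the expected
decrease when l vertices are fixed on the other side. *)
Lemma bin_exp_ratio (a b l k q : nat) : 0 < q -> 4 * q <= k ->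
  2 ^ l * b * q.+1 <= a * q -> 2 ^ (k * l + 4) * 'C(b, k) <= 'C(a, k).
Proof.
move=> q0 hk h; have [a0|a_gt0] := posnP a.
  have -> : b = 0.
    by apply/eqP; move: h; rewrite a0 mul0n leqn0 !muln_eq0 expn_eq0 orbF.
  by rewrite bin_small ?muln0 //; lia.
have hba : b <= a.
  have p0 : 0 < 2 ^ l by rewrite expn_gt0.
  have : b * q <= a * q by apply: leq_trans h; rewrite leq_mul // leq_pmull.
  by rewrite leq_pmul2r.
have h16 : 2 ^ 4 * q ^ k <= q.+1 ^ k.
  have [d ->] : exists d, k = q * 4 + d by exists (k - 4 * q); lia.
  rewrite !expnD !expnM mulnA -expnMn.
  by apply: leq_mul; apply: expn_mono => //; apply: double_exp_le.
have ak : 0 < a ^ k by rewrite expn_gt0 a_gt0.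
have qk : 0 < q ^ k by rewrite expn_gt0 q0.
rewrite -(leq_pmul2r (_ : 0 < a ^ k * q ^ k)) ?muln_gt0 ?ak //.
have := bin_ratio_le k hba; have := expn_mono k h; rewrite !expnMn -expnM.
rewrite expnD [l * k]mulnC; move: (2 ^ 4) h16 => d h16.
move: (2 ^ (k * l)) (a ^ k) (b ^ k) (q ^ k) (q.+1 ^ k) 'C(a, k) 'C(b, k) h16 =>
  P A B Q R x y h1 h2 h3.
have h4 : P * d * Q * (y * A) <= P * d * Q * (x * B)
  by rewrite leq_mul2l h3 orbT.
have h5 : P * x * B * (d * Q) <= P * x * B * R by rewrite leq_mul2l h1 orbT.
have h6 : x * (P * B * R) <= x * (A * Q) by rewrite leq_mul2l h2 orbT.
by lia.
Qed.

Lemma numK_rest_gt0 (T1 T2 : finType) (e : T1 -> T2 -> bool) (X : {set T1})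
    (Y : {set T2}) s k l S : S \in ksubsets X s ->
  0 < numK e (X :\: S) (common_nb e Y S) l k -> 0 < numK e X Y (s + l) k.
Proof.
move=> SX W0; have : 0 < 'C(s + l, s) * numK e X Y (s + l) k.
  by rewrite -sum_numK_rest (bigD1 S) //= addn_gt0 W0.
by rewrite muln_gt0 => /andP[].
Qed.

(** The next three lemmas follow the constants through a round, with E standing
for 2 ^ (4 * g).  The bounds a and b, which are at least
128 * E ^ 2 * (1 - 3 / (2 * g)), give b1 and a1 after a half-round, and these
give a2 and b2 after another one.  The losses add up so that a2 and b2 are
128 * E * (1 - 11 / (4 * g)) or more, up to terms that are small compared with
E / g: rounding errors and removed vertices.  The target is
128 * E * (1 - 12 / (4 * g)). *)
Lemma half_round_bound g E a b1 : 8 <= g -> 64 * g ^ 2 <= E ->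
  128 * E ^ 2 * (2 * g - 3) <= 2 * g * a ->
  b1 = (2 * g * a) %/ ((2 * g).+1 * E) ->
  128 * E * (2 * g - 3) <= (2 * g).+1 * b1.+1.
Proof.
move=> g8 hE ha eb.
have E0 : 0 < E by apply: leq_trans hE; rewrite muln_gt0 expn_gt0; lia.
have d0 : 0 < (2 * g).+1 * E by rewrite muln_gt0.
have := ltn_ceil (2 * g * a) d0; rewrite -eb => h.
rewrite -(leq_pmul2r E0).
have : 128 * E ^ 2 * (2 * g - 3) <= b1.+1 * ((2 * g).+1 * E)
  by apply: leq_trans ha (ltnW h).
by rewrite -mulnn; lia.
Qed.

Lemma round_left_bound g E s b1 a2 : 8 <= g -> s <= 24 * g -> 64 * g ^ 2 <= E ->
  128 * E * (2 * g - 3) <= (2 * g).+1 * b1.+1 ->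
  a2 = (4 * g * (b1 - s)) %/ (4 * g).+1 ->
  128 * E * (g - 3) <= g * a2.
Proof.
move=> g8 hs hE h1 ea.
have := ltn_ceil (4 * g * (b1 - s)) (ltn0Sn (4 * g)); rewrite -ea => h2.
rewrite -(leq_add2r g) -mulnSr.
rewrite -(@leq_pmul2r ((2 * g).+1 * (4 * g).+1)) ?muln_gt0 //.
have h3 : g * (4 * g * (b1 - s)) * (2 * g).+1 <=
  g * a2.+1 * ((2 * g).+1 * (4 * g).+1).
  have : g * (2 * g).+1 * (4 * g * (b1 - s)) <=
    g * (2 * g).+1 * (a2.+1 * (4 * g).+1) by rewrite leq_mul2l ltnW ?orbT.
  by lia.
apply: leq_trans h3.
have h4 : 4 * g * g * ((2 * g).+1 * b1.+1) <=
  g * (4 * g * (b1 - s)) * (2 * g).+1 + 4 * g * g * (2 * g).+1 * (24 * g).+1.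
  have : b1.+1 <= (b1 - s) + (24 * g).+1 by lia.
  move: (b1 - s) => z hz.
  have : 4 * g * g * (2 * g).+1 * b1.+1 <=
    4 * g * g * (2 * g).+1 * (z + (24 * g).+1) by rewrite leq_mul2l hz orbT.
  by lia.
have h5 : 4 * g * g * (128 * E * (2 * g - 3)) <=
  4 * g * g * ((2 * g).+1 * b1.+1) by rewrite leq_mul2l h1 orbT.
have {h4 h5} := leq_trans h5 h4.
move: (g * (4 * g * (b1 - s)) * (2 * g).+1) => Z.
have g8' := g8.
have [f ef] : exists f, g = f + 3 by exists (g - 3); lia.
rewrite ef.
rewrite (_ : f + 3 - 3 = f); last lia.
rewrite (_ : 2 * (f + 3) - 3 = 2 * f + 3); last lia.
have split_gain : 4 * (f + 3) * (f + 3) * (128 * E * (2 * f + 3)) =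
  128 * E * f * ((2 * (f + 3)).+1 * (4 * (f + 3)).+1)
  + 128 * E * (6 * ((f + 3) * (f + 3)) + 17 * (f + 3) + 3) by lia.
rewrite split_gain -ef; rewrite -mulnn in hE.
have gain : g * ((2 * g).+1 * (4 * g).+1)
      + 4 * g * g * ((2 * g).+1 * (24 * g).+1)
    <= 128 * E * (6 * (g * g) + 17 * g + 3).
  apply: (@leq_trans (128 * (64 * (g * g)) * (6 * (g * g)))); last first.
    by rewrite leq_mul ?leq_mul2l //; lia.
  have p1 : (2 * g).+1 * (4 * g).+1 <= 3 * g * (5 * g) by rewrite leq_mul //;
    lia.
  have p2 : (2 * g).+1 * (24 * g).+1 <= 3 * g * (25 * g) by rewrite leq_mul //;
    lia.
  have p3 : g * (3 * g * (5 * g)) <= g * g * (3 * g * (5 * g)).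
    by rewrite leq_mul2r leq_pmulr ?orbT //; lia.
  have p4 : g * ((2 * g).+1 * (4 * g).+1) <= g * (3 * g * (5 * g)).
    by rewrite leq_mul2l p1 orbT.
  have p5 : 4 * g * g * ((2 * g).+1 * (24 * g).+1) <=
    4 * g * g * (3 * g * (25 * g)).
    by rewrite leq_mul2l p2 orbT.
  by lia.
by lia.
Qed.

Lemma round_right_bound g E s b a1 b2 :
  8 <= g -> s <= 24 * g -> 64 * g ^ 2 <= E ->
  128 * E ^ 2 * (2 * g - 3) <= 2 * g * b ->
  a1 = (4 * g * (b - s)) %/ (4 * g).+1 ->
  b2 = (g * a1) %/ (g.+1 * E) ->
  128 * E * (g - 3) <= g * b2.
Proof.
move=> g8 hs hE hb ea eb.
have E0 : 0 < E by apply: leq_trans hE; rewrite muln_gt0 expn_gt0; lia.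
have := ltn_ceil (4 * g * (b - s)) (ltn0Sn (4 * g)).
rewrite -ea => h1.
have d0 : 0 < g.+1 * E by rewrite muln_gt0.
have := ltn_ceil (g * a1) d0; rewrite -eb => h2 {ea eb}.
rewrite -(leq_add2r g) -mulnSr.
rewrite -(@leq_pmul2r (g.+1 * (4 * g).+1 * E)) ?muln_gt0 ?E0 //.
have h3 : g * ((4 * g).+1 * (g * a1)) <= g * b2.+1 * (g.+1 * (4 * g).+1 * E).
  have : g * (4 * g).+1 * (g * a1) <= g * (4 * g).+1 * (b2.+1 * (g.+1 * E))
    by rewrite leq_mul2l ltnW ?orbT.
  by lia.
apply: leq_trans h3.
have h4 : g * g * (4 * g * b) <=
  g * ((4 * g).+1 * (g * a1)) + g * g * ((4 * g).+1 + 4 * g * (24 * g)).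
  have : 4 * g * b <= a1.+1 * (4 * g).+1 + 4 * g * (24 * g).
    apply: leq_trans (_ : 4 * g * (b - s) + 4 * g * (24 * g) <= _);
      last by rewrite leq_add2r ltnW.
    by rewrite -mulnDr leq_mul2l; apply/orP; right; lia.
  move=> h; have : g * g * (4 * g * b) <=
    g * g * (a1.+1 * (4 * g).+1 + 4 * g * (24 * g)) by rewrite leq_mul2l h orbT.
  by lia.
have h5 : g * g * (2 * (128 * E ^ 2 * (2 * g - 3))) <= g * g * (4 * g * b).
  by rewrite leq_mul2l; apply/orP; right; lia.
have {h4 h5} := leq_trans h5 h4.
move: (g * ((4 * g).+1 * (g * a1))) => Z.
have g8' := g8.
have [f ef] : exists f, g = f + 3 by exists (g - 3); lia.
rewrite ef.
rewrite (_ : f + 3 - 3 = f); last lia.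
rewrite (_ : 2 * (f + 3) - 3 = 2 * f + 3); last lia.
rewrite -!mulnn.
have split_gain : (f + 3) * (f + 3) * (2 * (128 * (E * E) * (2 * f + 3))) =
  128 * (E * E) * f * ((f + 3).+1 * (4 * (f + 3)).+1)
  + 128 * (E * E) * ((f + 3) * (f + 3) + 14 * (f + 3) + 3) by lia.
rewrite split_gain -ef; rewrite -mulnn in hE.
have gain : g * (g.+1 * (4 * g).+1 * E)
      + g * g * ((4 * g).+1 + 4 * g * (24 * g))
    <= 128 * (E * E) * (g * g + 14 * g + 3).
  apply: (@leq_trans (128 * (E * E) * (g * g))); last by rewrite leq_mul2l; lia.
  have p1 : g * (g.+1 * (4 * g).+1) <= g * (2 * g * (5 * g)).
    by rewrite leq_mul2l leq_mul ?orbT //; lia.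
  have p2 : g * (2 * g * (5 * g)) * E <= g * g * 10 * E * E.
    have gE : g <= E by apply: leq_trans hE; rewrite mulnA leq_pmull //; lia.
    have : g * g * 10 * E * g <= g * g * 10 * E * E
      by rewrite leq_mul2l gE orbT.
    by lia.
  have p3 : g * (g.+1 * (4 * g).+1) * E <= g * (2 * g * (5 * g)) * E.
    by rewrite leq_mul2r p1 orbT.
  have p4 : g * g * ((4 * g).+1 + 4 * g * (24 * g)) <= g * g * (101 * (E * E)).
    have q1 : (4 * g).+1 + 4 * g * (24 * g) <= 101 * (g * g).
      by have : 8 * g <= g * g by [rewrite leq_mul2r g8' orbT]; lia.
    rewrite leq_mul2l; apply/orP; right; apply: leq_trans q1 _.
    rewrite leq_mul2l /=; apply: (@leq_trans E); first by lia.
    by apply: leq_pmulr.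
  by lia.
by lia.
Qed.

Lemma sqr_le_exp16 g : 8 <= g -> 64 * g ^ 2 <= 2 ^ (4 * g).
Proof.
move=> g8; have h : g <= 2 ^ g by apply/ltnW/ltn_expl.
rewrite mulnC expnM (@leq_trans (g ^ 4)) //; last first.
  by rewrite -expnM mulnC expnM expn_mono.
by rewrite [g ^ 4](expnD g 2 2) leq_mul2l (leq_sqr 8) g8 orbT.
Qed.

(** A round fixes s vertices in each class; afterwards the sets to be fixed
have 4 * g vertices.  The range of s allows the first round to start from any
number of vertices, while s = 8 * g in all others. *)
Lemma rich_round (T1 T2 : finType) (e : T1 -> T2 -> bool) (X : {set T1})
    (Y : {set T2}) g s a b :
  8 <= g -> 8 * g <= s -> s <= 24 * g ->
  128 * (2 ^ (4 * g)) ^ 2 * (2 * g - 3) <= 2 * g * a ->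
  128 * (2 ^ (4 * g)) ^ 2 * (2 * g - 3) <= 2 * g * b ->
  rich e X Y s s a b ->
  exists X' Y' a' b',
    [/\ rich e X' Y' (4 * g) (4 * g) a' b',
        128 * 2 ^ (4 * g) * (g - 3) <= g * a',
        128 * 2 ^ (4 * g) * (g - 3) <= g * b' &
        forall p q, 0 < numK e X' Y' p q -> 0 < numK e X Y (s + p) (s + q)].
Proof.
move=> g8 hs1 hs2 ha hb st.
have hE := sqr_le_exp16 g8.
have h_gt0 : 0 < 4 * g by lia.
have le_hs : 2 * (4 * g) <= s by lia.
set E := 2 ^ (4 * g) in ha hb hE *.
have E0 : 0 < E by rewrite expn_gt0.
have big z : 128 * E ^ 2 * (2 * g - 3) <= 2 * g * z -> 64 * E <= z.
  move=> hz; rewrite -(@leq_pmul2l (2 * g)); last lia.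
  apply: leq_trans hz; rewrite -mulnn.
  have : 128 * E * 1 * g <= 128 * E * E * (2 * g - 3) by rewrite !leq_mul //;
    lia.
  by lia.
have {big} [a64 b64] := (big _ ha, big _ hb).
have gg : 64 * (g * g) <= E by rewrite mulnn.
have g2 : 8 * g <= g * g by rewrite leq_mul2r g8 orbT.
pose a1 := (4 * g * (b - s)) %/ (4 * g).+1.
pose b1 := (2 * g * a) %/ ((2 * g).+1 * E).
have n1 := half_round_bound g8 hE ha (erefl b1).
have b1_ge : 64 * E <= b1.+1.
  rewrite -(@leq_pmul2l (2 * g).+1) //; apply: leq_trans n1.
  have : 64 * E * (2 * g).+1 <= 64 * E * (2 * (2 * g - 3))
    by rewrite leq_mul2l; lia.
  by lia.
pose a2 := (4 * g * (b1 - s)) %/ (4 * g).+1.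
have n2 := round_left_bound g8 hs2 hE n1 (erefl a2).
pose b2 := (g * a1) %/ (g.+1 * E).
have n3 := round_right_bound g8 hs2 hE hb (erefl a1) (erefl b2).
have gs : g * s <= g * (24 * g) by rewrite leq_mul2l hs2 orbT.
have [||||||S SX st1] :=
  @rich_step _ _ e X Y s s (4 * g) a b a1 b1 _ _ _ _ _ _ st.
- exact: h_gt0.
- exact: le_hs.
- by clear - a64 gg g2 hs2 g8; lia.
- by clear - b64 gg g2 hs2 g8 gs; lia.
- apply: bin_halve h_gt0 _.
  by rewrite /a1; apply: leq_trunc_div.
- apply: (@bin_exp_ratio _ _ _ _ (2 * g));
    [by clear - g8; lia | by clear - hs1; lia | ].
  rewrite mulnAC (mulnC _ b1) (mulnC E) (mulnC a); exact: leq_trunc_div.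
have a1_ge : 4 * g <= a1.
  rewrite leq_divRL // leq_mul2l; apply/orP; right.
  by clear - b64 gg g2 hs2 g8; lia.
have [||||||T TY st2] :=
  @rich_step _ _ _ _ _ s (4 * g) (4 * g) a1 b1 a2 b2 _ _ _ _ _ _ st1.
- exact: h_gt0.
- exact: le_hs.
- exact: a1_ge.
- by clear - b1_ge gg g2 hs2 g8 gs; lia.
- apply: bin_halve h_gt0 _.
  by rewrite /a2; apply: leq_trunc_div.
- apply: (@bin_exp_ratio _ _ _ _ g); [by clear - g8; lia | exact: leqnn | ].
  rewrite mulnAC (mulnC _ b2) (mulnC E) (mulnC a1); exact: leq_trunc_div.
exists (common_nb (converse e) (X :\: S) T), (common_nb e Y S :\: T), a2, b2;
  split => // p q.
rewrite numK_converse => /(numK_rest_gt0 TY); rewrite -numK_converse.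
exact: numK_rest_gt0.
Qed.

(** * The last round and the induction *)

(** Once S is fixed, s more vertices complete the left side, so that l = s and
no density has to be preserved: it is enough that, in what remains, some s-set
has 2 * s common neighbours, which holds as soon as the average number of
s-subsets of a common neighbourhood is at least 'C(2 * s, s). *)
Lemma rich_final (T1 T2 : finType) (e : T1 -> T2 -> bool) (X : {set T1})
    (Y : {set T2}) s a b :
  0 < s -> s <= a -> 2 * s * (s + s) <= b ->
  2 ^ (s * s + 6) * 'C(2 * s, s) <= 'C(a, s) ->
  rich e X Y s s a b -> 0 < numK e X Y (s + s) (s + s).
Proof.
move=> s0 sa hb hC st.
have sb : s <= b by nia.
have [c [S [bc hx SX hS]]] := exists_extension s s0 sb st.
apply: numK_rest_gt0 (SX) _.
have hx2 : 'C(#|X|, s) <= 2 * 2 ^ (s * s + 4) * 'C(c - s, s).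
  by apply: bin_le_of_exp hx; lia.
move: SX; rewrite inE => /andP[SX _].
have hx' : 'C(#|X :\: S|, s) <= 'C(#|X|, s).
  by apply/leq_bin2l/subset_leq_card/subsetDl.
have w0 : 0 < 'C(c - s, s) by rewrite bin_gt0; nia.
have a0 : 0 < 'C(a, s) by rewrite bin_gt0.
have hW : 'C(#|X :\: S|, s) * 'C(2 * s, s) <=
  numK e (X :\: S) (common_nb e Y S) s s.
  have e2 : 2 ^ (s * s + 6) = 2 * (2 * 2 ^ (s * s + 4)) by rewrite !expnD; lia.
  rewrite e2 in hC; move: hx2 hC.
  have r0 : 0 < 2 * 2 ^ (s * s + 4) by rewrite muln_gt0 expn_gt0.
  move: (2 * 2 ^ (s * s + 4)) r0 => r r0 hx2 hC.
  rewrite -(@leq_pmul2l (2 * r)) ?muln_gt0 //.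
  have h1 := leq_mul (leq_trans hx' hx2) hC.
  have h2 : r * ('C(c - s, s) * ('C(#|common_nb e Y S|, s) + 'C(a, s))) <=
    r * (2 * numK e (X :\: S) (common_nb e Y S) s s)
      by rewrite leq_mul2l hS orbT.
  move: h1 h2; rewrite !mulnDr; lia.
have W0 : 0 < numK e (X :\: S) (common_nb e Y S) s s.
  rewrite -(@ltn_pmul2l 2) // muln0; apply: leq_trans hS.
  by rewrite muln_gt0 w0 addn_gt0 a0 orbT.
have lt : 'C((2 * s).-1, s) < 'C(2 * s, s).
  case: (s) s0 => // n _; have -> : 2 * n.+1 = (2 * n).+2 by lia.
  by rewrite /= [ltnRHS]binS -[ltnLHS]addn0 ltn_add2l bin_gt0; lia.
have X0 : 0 < 'C(#|X :\: S|, s).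
  by have := leq_trans W0 (numK_le _ _ _ _ _); rewrite muln_gt0 => /andP[].
apply: numK_pigeonhole (s) _ _; apply: leq_trans hW.
by rewrite ltn_pmul2l // addnn -mul2n.
Qed.

(** A constant C of 10 * q = 2 * s * (5 / 4) suffices for the last round,
since (5 / 4) ^ s = (5 / 4) ^ (4 * q) >= 2 ^ q >= 2 ^ 6. *)
Lemma bin_final_ratio q a : 6 <= q -> 10 * q * 2 ^ (4 * q) <= a ->
  2 ^ (4 * q * (4 * q) + 6) * 'C(2 * (4 * q), 4 * q) <= 'C(a, 4 * q).
Proof.
move=> q6; set s := 4 * q => h.
have hba : 2 * s <= a.
  apply: leq_trans h; rewrite /s.
  have : 8 * q * 1 <= 10 * q * 2 ^ (4 * q) by rewrite leq_mul ?expn_gt0 //; lia.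
  lia.
have h45 : 2 ^ 6 * 4 ^ s <= 5 ^ s.
  apply: (@leq_trans (2 ^ q * 4 ^ s));
    first by rewrite leq_mul2r leq_exp2l // q6 orbT.
  by rewrite !expnM -expnMn expn_mono.
have b0 : 0 < (2 * s) ^ s by rewrite expn_gt0; lia.
rewrite -(leq_pmul2r b0); apply: leq_trans (bin_ratio_le s hba).
rewrite mulnAC [leqRHS]mulnC leq_mul2r; apply/orP; right.
have h' : 5 * (2 * s * 2 ^ s) <= 4 * a by rewrite /s in h *; lia.
have := expn_mono s h'.
rewrite (expnMn 5) (expnMn (2 * s)) (expnMn 4) -expnM => ha.
have s0 : 0 < 4 ^ s by rewrite expn_gt0.
rewrite -(leq_pmul2l s0); apply: leq_trans ha.
rewrite expnD; move: ((2 * s) ^ s) (2 ^ (s * s)) h45 => y z.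
move: (2 ^ 6) (4 ^ s) (5 ^ s) => u v w huv.
have : u * v * (y * z) <= w * (y * z) by rewrite leq_mul2r huv orbT.
by lia.
Qed.

Lemma rich_numK_gt0 (T1 T2 : finType) (e : T1 -> T2 -> bool) m :
  forall g (X : {set T1}) (Y : {set T2}) a b, g = 8 * 2 ^ m ->
  rich e X Y (4 * g) (4 * g) a b ->
  128 * 2 ^ (4 * g) * (g - 3) <= g * a ->
  128 * 2 ^ (4 * g) * (g - 3) <= g * b ->
  0 < numK e X Y (8 * g) (8 * g).
Proof.
elim: m => [|m IH] g X Y a b eg st ha hb.
  have g8 : g = 8 by rewrite eg.
  have hE := sqr_le_exp16 (_ : 8 <= g).
  rewrite (_ : 8 * g = 4 * g + 4 * g); last lia.
  have E8 := hE (eq_leq (esym g8)).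
  have ga : 10 * g * 2 ^ (4 * g) <= a.
    by move: ha {hb st E8 hE}; rewrite -(@leq_pmul2l g) ?g8 //; move: (2 ^ _);
      lia.
  have gb : 80 * 2 ^ (4 * g) <= b.
    by move: hb {ha st E8 hE ga}; rewrite -(@leq_pmul2l g) ?g8 //;
      move: (2 ^ _); lia.
  move: E8; rewrite -mulnn => E8.
  apply: rich_final st; [lia| | |].
  - by move: ga E8; rewrite g8; move: (2 ^ _); lia.
  - by move: gb E8; rewrite g8; move: (2 ^ _); lia.
  - by apply: bin_final_ratio => //; rewrite g8.
set g' := 8 * 2 ^ m.
have eg' : g = 2 * g' by rewrite eg expnS /g'; lia.
have g8 : 8 <= g' by rewrite leq_pmulr // expn_gt0.
have eE : 2 ^ (4 * g) = (2 ^ (4 * g')) ^ 2 by rewrite -expnM; congr (_ ^ _);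
  lia.
rewrite eE eg' in ha hb.
have [X' [Y' [a' [b' [st' ha' hb' lift]]]]] :=
  @rich_round _ _ e X Y g' (4 * g) a b g8 ltac:(lia) ltac:(lia) ha hb st.
have := lift _ _ (IH g' X' Y' a' b' erefl st' ha' hb').
by rewrite (_ : 4 * g + 8 * g' = 8 * g) //; lia.
Qed.

(** * From density 1/2 to a rich pair *)

Lemma sum_ksubsets1 (T : finType) (X : {set T}) (F : {set T} -> nat) :
  \sum_(S in ksubsets X 1) F S = \sum_(x in X) F [set x].
Proof.
rewrite -(big_imset (h := set1) F) /=; last by move=> x y _ _; apply: set1_inj.
apply: eq_bigl => S; rewrite inE;
  apply/andP/imsetP => [[SX /cards1P[x eS]]|[x xX ->]].
  by exists x => //; move: SX; rewrite eS sub1set.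
by rewrite sub1set xX cards1.
Qed.

Lemma dense_color n (col : {ffun 'I_n * 'I_n -> 'I_2}) N : n = 2 * N ->
  exists c, N * n <= numK (fun a b => col (a, b) == c) setT setT 1 1.
Proof.
move=> en.
have tot :
    \sum_(c : 'I_2) numK (fun a b => col (a, b) == c) setT setT 1 1 = n * n.
  under eq_bigr do rewrite /numK sum_ksubsets1.
  rewrite exchange_big /=; transitivity (\sum_(a in [set: 'I_n]) n);
    last by rewrite sum_nat_const cardsT card_ord.
  apply: eq_bigr => a _.
  transitivity #|'I_n|; last exact: card_ord.
  rewrite -[RHS]sum1_card (partition_big (fun b => col (a, b)) predT) //=.
  apply: eq_bigr => c _; rewrite bin1 -sum1_card; apply: eq_bigl => b.
  by rewrite !inE /=; apply/forall_inP/idP => [->|h x];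
    rewrite ?inE // => /eqP->.
move: tot; rewrite big_ord_recl big_ord_recl big_ord0 addn0.
case: (leqP (N * n) (numK (fun a b => col (a, b) == ord0) setT setT 1 1)) =>
  [h _|]; first by exists ord0.
set c := lift _ _ => h1 h2; exists c; move: h1 h2.
by have : n * n = 2 * (N * n) by [rewrite {1}en mulnA]; lia.
Qed.

(** Jensen's inequality for the degrees of the vertices of Y. *)
Lemma star_count (T1 T2 : finType) (e : T1 -> T2 -> bool) (X : {set T1})
    (Y : {set T2}) N s : 0 < N -> 0 < s ->
  N * #|Y| <= numK e X Y 1 1 -> #|Y| * 'C(N, s) <= numK e X Y s 1.
Proof.
move=> N0; case: s => // s _ h.
have := @bin_power_mean _ (ksubsets Y 1) (fun K =>
  #|common_nb (converse e) X K|) 1 s N (ltn0Sn 0).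
rewrite card_ksubsets !bin1 -[X in _ <= X -> _]/(numK (converse e) Y X 1 1).
rewrite -numK_converse.
rewrite [#|Y| * N]mulnC => /(_ h).
rewrite add1n -[X in _ * X <= _]/(numK (converse e) Y X 1 1) -numK_converse.
rewrite -[X in _ <= _ * X]/(numK (converse e) Y X 1 s.+1) -numK_converse => h2.
rewrite -(leq_pmul2l N0); apply: leq_trans h2.
by rewrite mulnA mulnC leq_mul2l h orbT.
Qed.

(** Without replacement, the probability that s random elements fall in a
given half of an n-set is at least 2 ^ - s * (1 - 2 * s ^ 2 / n). *)
Lemma bin_half_ratio n N M s : n = 2 * N -> 0 < s ->
  M * 2 ^ s + 2 * s ^ 2 <= n -> M * 'C(n, s) <= n * 'C(N, s).
Proof.
move=> en s0 h.
rewrite -(leq_pmul2r (fact_gt0 s)) -!mulnA !bin_ffact.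
apply: leq_trans (_ : M * n ^ s <= _);
  first by rewrite leq_mul2l ffact_le_exp orbT.
apply: leq_trans (_ : n * (N - s) ^ s <= _); last first.
  rewrite leq_mul2l; apply/orP; right; apply: leq_trans (subn_exp_le_ffact _ _).
  by apply: expn_mono; lia.
have p2 : 0 < 2 ^ s by rewrite expn_gt0.
rewrite -(leq_pmul2l p2) [leqRHS]mulnCA -expnMn.
have -> : 2 * (N - s) = n - 2 * s by lia.
have h1 := leq_mul (leqnn n) (expn_sub_ge n (2 * s) s).
have h2 : (M * 2 ^ s + 2 * s ^ 2) * n ^ s <= n * n ^ s
  by rewrite leq_mul2r h orbT.
have h3 : n ^ s = n * n ^ s.-1 by rewrite -expnS prednK.
rewrite h3 -mulnn in h1 h2 *.
by move: ((n - 2 * s) ^ s) (n ^ s.-1) (2 ^ s) h1 h2; lia.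
Qed.

Lemma sqr_le_exp2 s : 7 <= s -> 2 * s ^ 2 <= 2 ^ s.
Proof.
elim: s => // s IH; rewrite ltnS leq_eqVlt => /predU1P[<-|s7] //.
have := IH s7; rewrite (expnS 2) -!mulnn; move: (2 ^ s) => p h.
have : 7 * s <= s * s by rewrite leq_mul2r s7 orbT.
by lia.
Qed.

(** The number of K_{s,s} is bounded by the power mean inequality twice: for
the degrees in Y, then for the common neighbourhoods of the s-subsets of X.
As the classes have equal size, the three bounds of [rich] come from a single
one. *)
Lemma dense_rich (T1 T2 : finType) (e : T1 -> T2 -> bool) (X : {set T1})
    (Y : {set T2}) n s F : n = 128 * 2 ^ s * F -> #|X| = n -> #|Y| = n ->
  n./2 * n <= numK e X Y 1 1 ->
  7 <= s -> 2 * s ^ 2 <= 128 * F ->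
  rich e X Y s s (128 * F).-1 (128 * F).-1.
Proof.
move=> en cX cY h s7 hF.
have s0 : 0 < s by lia.
set M := (128 * F).-1.
have eM : M.+1 = 128 * F by rewrite prednK //; nia.
have nE : n = 2 ^ s * M.+1 by rewrite eM en; lia.
have n2 : n = 2 * n./2.
  rewrite mul2n; apply/esym; apply: even_halfK.
  by rewrite en !oddM.
have s2 := sqr_le_exp2 s7.
have le_sM : s <= M.
  have : 2 * s * s <= M.+1 by rewrite eM; move: hF; rewrite -mulnn; lia.
  by nia.
have N0 : 0 < n./2 by have : 0 < 2 ^ s by [rewrite expn_gt0]; nia.
have st := @star_count _ _ e X Y _ _ N0 s0.
rewrite cY in st; have {}st := st h.
have hM : 'C(n, s) * 'C(M, 1) <= numK e X Y s 1.
  rewrite bin1 mulnC; apply: leq_trans st; apply: bin_half_ratio => //.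
  by rewrite nE; move: s2; rewrite mulnS; lia.
have W : 'C(n, s) * 'C(M, s) <= numK e X Y s s.
  have := @bin_power_mean _ (ksubsets X s) (fun S =>
    #|common_nb e Y S|) 1 s.-1 M (ltn0Sn 0).
  rewrite card_ksubsets cX => /(_ hM); rewrite add1n prednK // bin1 => pm.
  have M0 : 0 < M by lia.
  rewrite -(leq_pmul2l M0); apply: leq_trans pm.
  by move: hM; rewrite bin1 /numK => hM;
    rewrite mulnA [M * _]mulnC mulnC leq_mul2l hM orbT.
have le_sn : s <= n by apply: leq_trans le_sM _; rewrite nE;
  have : 0 < 2 ^ s by [rewrite expn_gt0]; nia.
have W0 : 0 < numK e X Y s s by apply: leq_trans W;
  rewrite muln_gt0 !bin_gt0 le_sn.
split; rewrite ?cX ?cY // 1?mulnC //.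
rewrite mulnC; apply: leq_trans (_ : 2 ^ (s * s + 4) * ('C(n, s) * 'C(M, s)) <=
  _); last by rewrite leq_mul2l W orbT.
rewrite mulnCA leq_mul2l; apply/orP; right.
apply: leq_trans (@bin_le_of_exp n M 0 s (2 ^ (s * s)) _ _) _.
- by rewrite eM; move: hF; rewrite -mulnn; lia.
- by rewrite nE expnMn -expnM.
- by rewrite subn0 leq_mul2r expnD; lia.
Qed.

(** * Finding K_{t,t} *)

(** The number of vertices left after the first round is 8 * g, where g is 8
times a power of 2 and t is between 16 * g and 32 * g, so that the sets fixed
in the first round have between 8 * g and 24 * g vertices. *)
Lemma dense_numK_gt0 (T1 T2 : finType) (e : T1 -> T2 -> bool) (X : {set T1})
    (Y : {set T2}) t : 0 < t ->
  #|X| = 128 * 2 ^ t -> #|Y| = 128 * 2 ^ t ->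
  64 * 2 ^ t * (128 * 2 ^ t) <= numK e X Y 1 1 -> 0 < numK e X Y t t.
Proof.
move=> t0 cX cY h.
have E0 : 0 < 2 ^ t by rewrite expn_gt0.
have [t_small|t_big] := ltnP t 128.
  have st := @star_count _ _ e X Y (64 * 2 ^ t) t _ t0.
  rewrite cY in st; have {}st := st ltac:(lia) h.
  have hr : t * 'C(128 * 2 ^ t, t) <= 128 * 2 ^ t * 'C(64 * 2 ^ t, t).
    apply: bin_half_ratio => //; first by lia.
    have [t7|t7] := ltnP t 7; last first.
      have := sqr_le_exp2 t7; move: (2 ^ t) (2 * t ^ 2) E0 => p q p0 hq.
      have : t * p <= 127 * p by rewrite leq_mul2r -ltnS t_small orbT.
      by lia.
    have : t ^ 2 <= 36 by rewrite (@leq_exp2r t 6 2).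
    have : t * 2 ^ t <= 6 * 2 ^ t by rewrite leq_mul2r -ltnS t7 orbT.
    by move: (2 ^ t) (t ^ 2) E0; lia.
  apply: (@numK_pigeonhole _ _ _ _ _ _ 1); apply: leq_trans (leq_trans hr st).
  rewrite cX bin1 mulnC ltn_pmul2r ?prednK // bin_gt0.
  apply: leq_trans (ltnW (ltn_expl t (ltnSn 1))) _.
  by rewrite leq_pmull.
pose m := trunc_log 2 (t %/ 128); pose g := 8 * 2 ^ m.
have /andP[m1 m2] : 2 ^ m <= t %/ 128 < 2 ^ m.+1.
  by apply: trunc_log_bounds => //; rewrite divn_gt0.
have hg1 : 16 * g <= t by move: m1; rewrite leq_divRL // /g; lia.
have hg2 : t < 32 * g by move: m2; rewrite ltn_divLR // expnS /g; lia.
have g8 : 8 <= g by rewrite leq_pmulr // expn_gt0.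
have eg : g = 8 * 2 ^ m by [].
move: g eg hg1 hg2 g8 => g eg hg1 hg2 g8 {m1 m2}.
have [s es] : exists s, t = s + 8 * g by exists (t - 8 * g); lia.
have s8 : 8 * g <= s by lia.
have s24 : s <= 24 * g by lia.
have et : 2 ^ t = 2 ^ s * 2 ^ (8 * g) by rewrite -expnD es.
have e8 : 2 ^ (8 * g) = (2 ^ (4 * g)) ^ 2 by rewrite -expnM; congr (_ ^ _); lia.
have hE := sqr_le_exp16 g8.
have st : rich e X Y s s (128 * 2 ^ (8 * g)).-1 (128 * 2 ^ (8 * g)).-1.
  apply: (@dense_rich _ _ _ _ _ (128 * 2 ^ t)) => //.
  - by rewrite et; lia.
  - by rewrite (_ : (128 * 2 ^ t)./2 = 64 * 2 ^ t) //; lia.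
  - by lia.
  - have ss := leq_mul s24 s24.
    have EE := leq_mul hE (leq_trans _ hE : 0 < 2 ^ (4 * g)).
    rewrite e8 -!mulnn; rewrite -mulnn in EE.
    have {}EE := EE ltac:(lia); lia.
have size_ok : 128 * (2 ^ (4 * g)) ^ 2 * (2 * g - 3) <=
  2 * g * (128 * 2 ^ (8 * g)).-1.
  have gQ : g <= 2 ^ (8 * g).
    by apply: leq_trans (ltnW (ltn_expl g (ltnSn 1))) _;
      rewrite leq_exp2l ?leq_pmull.
  have {}gQ : g <= (128 * 2 ^ (8 * g)).-1.
    by move: gQ; case: (2 ^ (8 * g)) => [|q] hq; lia.
  have Q0 : 0 < 128 * 2 ^ (8 * g) by rewrite muln_gt0 expn_gt0.
  rewrite -e8 -{1}(prednK Q0); move: _.-1 gQ => z gQ.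
  have [w ew] : exists w, 2 * g = w + 3 by exists (2 * g - 3); lia.
  by rewrite ew addnK; lia.
have [X' [Y' [a' [b' [st' ha' hb' lift]]]]] :=
  rich_round g8 s8 s24 size_ok size_ok st.
by rewrite es; apply: lift; apply: rich_numK_gt0 eg st' ha' hb'.
Qed.

Theorem corollary1p2 (t : nat) (ht : 1 <= t) : bip_ramsey 2 t <= 128 * 2 ^ t.
Proof.
rewrite /bip_ramsey; case: ex_minnP => n _; apply; apply/forallP => col.
have [c hc] := @dense_color _ col (64 * 2 ^ t) ltac:(lia).
have := @dense_numK_gt0 _ _ _ setT setT t ht _ _ hc.
rewrite cardsT card_ord => /(_ erefl erefl).
rewrite lt0n sum_nat_eq0 => /forall_inPn[A]; rewrite inE => /andP[_ cA].
rewrite -lt0n bin_gt0 => /subset_of_card[B /subsetP sB cB].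
apply/existsP; exists c; apply/existsP; exists A; apply/existsP; exists B.
rewrite cA cB eqxx; apply/forall_inP => a aA; apply/forall_inP => b /sB.
by rewrite inE => /andP[_ /forall_inP/(_ a aA)].
Qed.
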